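(* Let $P=\{x\in\mathbb{R}^n : H^Tx\le \mathbb{1}\}$ be a full-dimensional polytope with the origin in its interior and $f$ facets. Let $D_0^1=\{x\in\mathbb{R}^n : \|H^Tx\|\le 1\}$ be the Dikin ellipsoid of $P$ centered at the origin with radius $1$. Then $$D_0^1\subseteq \mathrm{Inn}_P(0)\subseteq P .$$
   Context: $\|\cdot\|$ is the Euclidean norm and $\mathbb{1}$ is the all-ones vector. $H=[h_1\ \cdots\ h_f]$ is an $n\times f$ matrix such that each inequality $\langle h_i,x\rangle\le 1$ defines a facet of $P$ (one for each facet). Let $\mathcal{O}_{in}^f=\{x\in\mathbb{R}^f : \sqrt{f-1}\,\|x\|\le \mathbb{1}^Tx\}$ and $\mathrm{Inn}_P(0)=\{x\in\mathbb{R}^n : \mathbb{1}-H^Tx\in\mathcal{O}_{in}^f\}$. *)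

(* Defs.v *)
From HB Require Import structures.
From mathcomp Require Import all_boot all_order all_algebra.
From mathcomp Require Import all_classical all_reals all_analysis.

Set Implicit Arguments.
Unset Strict Implicit.
Unset Printing Implicit Defensive.

Import Order.TTheory GRing.Theory Num.Theory.
Import numFieldNormedType.Exports.

Local Open Scope classical_set_scope.
Local Open Scope ring_scope.

(* Points of R^n are column vectors. The library norm `|x| on 'cV[R]_n is the
   sup norm, so the Euclidean norm is defined separately; the library topology
   on 'cV[R]_n is the usual one. *)
Definition dot (R : realType) (n : nat) (u v : 'cV[R]_n) : R :=
  \sum_(i < n) u i 0 * v i 0.

Definition enorm (R : realType) (n : nat) (x : 'cV[R]_n) : R :=
  Num.sqrt (\sum_(i < n) x i 0 ^+ 2).

Definition ones (R : realType) (n : nat) : 'cV[R]_n := const_mx 1.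
Arguments ones {R n}.

(* A polytope is the convex hull of finitely many points (the columns of V). *)
Definition polytope (R : realType) (n : nat) (P : set 'cV[R]_n) : Prop :=
  exists (m : nat) (V : 'M[R]_(n, m)),
    P = [set V *m w | w in
          [set w : 'cV[R]_m | (forall i, 0 <= w i 0) /\ \sum_(i < m) w i 0 = 1]].

Definition affindep (R : realType) (n k : nat) (p : 'I_k -> 'cV[R]_n) : Prop :=
  forall c : 'I_k -> R,
    \sum_(i < k) c i = 0 -> \sum_(i < k) c i *: p i = 0 -> forall i, c i = 0.

(* [has_dim S d]: the affine hull of S has dimension d, i.e. d + 1 is the largest
   size of an affinely independent family in S. The empty set has dimension -1. *)
Definition has_dim (R : realType) (n : nat) (S : set 'cV[R]_n) (d : int) : Prop :=
  exists k : nat,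
    [/\ d = k%:Z - 1,
        exists p : 'I_k -> 'cV[R]_n, (forall i, S (p i)) /\ affindep p &
        forall (m : nat) (p : 'I_m -> 'cV[R]_n),
          (forall i, S (p i)) -> affindep p -> (m <= k)%N].

Definition full_dimensional (R : realType) (n : nat) (S : set 'cV[R]_n) : Prop :=
  has_dim S n%:Z.

(* The part of P on which the inequality <c, x> <= b is tight. *)
Definition tight_part (R : realType) (n : nat) (P : set 'cV[R]_n)
    (c : 'cV[R]_n) (b : R) : set 'cV[R]_n :=
  [set x | P x /\ dot c x = b].

Definition face (R : realType) (n : nat) (P F : set 'cV[R]_n) : Prop :=
  exists (c : 'cV[R]_n) (b : R),
    (forall x, P x -> dot c x <= b) /\ F = tight_part P c b.

Definition facet (R : realType) (n : nat) (P F : set 'cV[R]_n) : Prop :=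
  face P F /\ exists d : int, has_dim P d /\ has_dim F (d - 1).

(* The inequalities <h_i, x> <= 1, with h_i the columns of H, define the facets
   of P, each facet being defined by exactly one of them. In particular P has
   exactly f facets. *)
Definition facet_defining (R : realType) (n f : nat) (H : 'M[R]_(n, f))
    (P : set 'cV[R]_n) : Prop :=
  set_bij [set: 'I_f] [set F | facet P F] (fun i => tight_part P (col i H) 1).

Definition polyhedron (R : realType) (n f : nat) (H : 'M[R]_(n, f)) :
    set 'cV[R]_n :=
  [set x | forall i, (H^T *m x) i 0 <= (ones : 'cV[R]_f) i 0].

Definition O_in (R : realType) (f : nat) : set 'cV[R]_f :=
  [set x | Num.sqrt (f%:R - 1) * enorm x <= dot ones x].
Arguments O_in : clear implicits.

(* Inn_P(0), where P is the polytope with facet inequalities H^T x <= 1. *)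
Definition Inn0 (R : realType) (n f : nat) (H : 'M[R]_(n, f)) : set 'cV[R]_n :=
  [set x | O_in R f (ones - H^T *m x)].

(* The Dikin ellipsoid D_0^1; the slack vector at the origin is the all-ones
   vector, so no rescaling of the rows of H^T appears. *)
Definition Dikin0 (R : realType) (n f : nat) (H : 'M[R]_(n, f)) : set 'cV[R]_n :=
  [set x | enorm (H^T *m x) <= 1].

(* Main.v *)
Require Import Defs.
From mathcomp Require Import all_boot all_order all_algebra.
From mathcomp Require Import all_classical all_reals all_analysis.
From mathcomp Require Import ring lra.
Import Order.TTheory GRing.Theory Num.Theory.
Import numFieldNormedType.Exports.
Local Open Scope classical_set_scope.
Local Open Scope ring_scope.

(** For a slack vector [z] in the cone, membership squares to
    [(f - 1) * sum z_i^2 <= (sum z_i)^2].  With [z = 1 - y] the difference of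
    the two sides is [(s - 1)^2 + (f - 1) * (1 - q)], where [s] and [q] are the
    sums of the [y_i] and of the [y_i^2]; this gives the first inclusion.  For
    the second one, a coordinate [z_i < 0] of a point of the cone would make
    [sum z_j] smaller than the sum over [j != i], which Cauchy-Schwarz on [f - 1]
    coordinates bounds by [sqrt (f - 1) * ||z||]. *)

Lemma sqr_sum_le_card (R : realFieldType) (I : finType) (A : pred I)
    (z : I -> R) :
  (\sum_(i in A) z i) ^+ 2 <= #|A|%:R * \sum_(i in A) z i ^+ 2.
Proof.
set T := \sum_(i in A) z i; set Q := \sum_(i in A) z i ^+ 2.
have [A0|A_gt0] := posnP #|A|.
  rewrite A0 mul0r /T big_pred0 ?expr0n // => i; exact: card0_eq A0 i.
have : 0 <= \sum_(i in A) (#|A|%:R * z i - T) ^+ 2.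
  by apply: sumr_ge0 => i _; exact: sqr_ge0.
have -> : \sum_(i in A) (#|A|%:R * z i - T) ^+ 2 =
    #|A|%:R * (#|A|%:R * Q - T ^+ 2).
  rewrite (eq_bigr (fun i => #|A|%:R ^+ 2 * z i ^+ 2
    + (- 2 * #|A|%:R * T) * z i + T ^+ 2)) => [|i _]; last by ring.
  rewrite !big_split /= -!mulr_sumr sumr_const -/T -/Q -[T *+ _]mulr_natl.
  by ring.
by rewrite pmulr_rge0 ?ltr0n // subr_ge0.
Qed.

Lemma dot_ones (R : realType) (f : nat) (z : 'cV[R]_f) :
  dot ones z = \sum_i z i 0.
Proof. by apply: eq_bigr => i _; rewrite mxE mul1r. Qed.

Lemma O_inP (R : realType) (f : nat) (z : 'cV[R]_f) : (0 < f)%N ->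
  O_in R f z <->
  0 <= \sum_i z i 0 /\
  (f%:R - 1) * \sum_i z i 0 ^+ 2 <= (\sum_i z i 0) ^+ 2.
Proof.
move=> f_gt0; rewrite /O_in /= /enorm dot_ones.
have f1 : 0 <= f%:R - 1 :> R by rewrite subr_ge0 ler1n.
rewrite -sqrtrM //; set a := _ * _; set s := \sum_i _.
have a0 : 0 <= a.
  by apply: mulr_ge0 => //; apply: sumr_ge0 => i _; exact: sqr_ge0.
split=> [le_s | [s0 le_s]].
  have s0 : 0 <= s := le_trans (sqrtr_ge0 a) le_s.
  by split=> //; rewrite -(sqr_sqrtr a0) ler_sqr ?nnegrE ?sqrtr_ge0.
by rewrite -(ger0_norm s0) -sqrtr_sqr ler_wsqrtr.
Qed.

Lemma O_in_ge0 (R : realType) (f : nat) (z : 'cV[R]_f) (i : 'I_f) :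
  O_in R f z -> 0 <= z i 0.
Proof.
have f_gt0 : (0 < f)%N := leq_ltn_trans (leq0n i) (ltn_ord i).
move=> /(O_inP _ _ _ f_gt0)[]; rewrite leNgt (bigD1 i) //=.
rewrite [\sum_j _ ^+ 2](bigD1 i) //=.
have := @sqr_sum_le_card R _ (predC1 i) (fun j => z j 0).
rewrite cardC1 card_ord -subn1 natrB //.
set T := \sum_(j | _) z j 0; set Q := \sum_(j | _) _ ^+ 2.
have f1 : 0 <= f%:R - 1 :> R by rewrite subr_ge0 ler1n.
move: (z i 0) => t leT S0 leS; apply/negP => t_lt0.
have := mulr_ge0 f1 (sqr_ge0 t).
by nra.
Qed.

Lemma O_in_ones_sub (R : realType) (f : nat) (y : 'cV[R]_f) :
  enorm y <= 1 -> O_in R f (ones - y).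
Proof.
have [f0|f_gt0] := posnP f.
  by subst f; rewrite /O_in /= /enorm dot_ones !big_ord0 sqrtr0 mulr0.
have q0 : 0 <= \sum_i y i 0 ^+ 2 by apply: sumr_ge0 => i _; exact: sqr_ge0.
move=> y_le1; apply/O_inP => //.
have : \sum_i y i 0 ^+ 2 <= 1.
  by rewrite -(sqr_sqrtr q0) expr_le1 // sqrtr_ge0.
have -> : \sum_i (ones - y) i 0 = f%:R - \sum_i y i 0.
  under eq_bigr => i _ do rewrite !mxE.
  by rewrite big_split /= sumr_const card_ord sumrN.
have -> : \sum_i (ones - y) i 0 ^+ 2 =
    f%:R - 2 * \sum_i y i 0 + \sum_i y i 0 ^+ 2.
  rewrite (eq_bigr (fun i => 1 + (- 2) * y i 0 + y i 0 ^+ 2)) => [|i _];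
    last by rewrite !mxE; ring.
  by rewrite !big_split /= sumr_const card_ord -mulr_sumr mulNr.
have := sqr_sum_le_card R 'I_f 'I_f (fun i => y i 0).
rewrite card_ord; set s := \sum_i y i 0; set q := \sum_i _ ^+ 2 => s_le q_le1.
have f1 : 1 <= f%:R :> R by rewrite ler1n.
split; first by rewrite subr_ge0 leNgt; apply/negP => f_lt_s; nra.
rewrite -subr_ge0 (_ : _ - _ = (s - 1) ^+ 2 + (f%:R - 1) * (1 - q)); last by ring.
by rewrite addr_ge0 ?sqr_ge0 // mulr_ge0 ?subr_ge0.
Qed.

Theorem mainTheorem6 (R : realType) (n f : nat) (H : 'M[R]_(n, f))
    (P : set 'cV[R]_n)
    (hP : P = polyhedron H)
    (hpoly : polytope P)
    (hfull : full_dimensional P)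
    (h0 : interior P 0)
    (hfacets : facet_defining H P) :
  Dikin0 H `<=` Inn0 H /\ Inn0 H `<=` P.
Proof.
split=> [x|x x_in]; first exact: O_in_ones_sub.
rewrite hP => i.
by have := O_in_ge0 _ _ _ i x_in; rewrite mxE [X in _ + X]mxE subr_ge0.
Qed.
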